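(* Let $P$ be a tree poset of height $h$, and suppose there is an element $x\in P$ with the following property: for every $\varepsilon>0$ there exists $\delta>0$ such that for every sufficiently large $n\in\mathbb N$, every family $\mathcal F\subseteq 2^{[n]}$ with $|\mathcal F|\ge (h-1+\varepsilon)\binom{n}{\lfloor n/2\rfloor}$ contains a copy of the blow-up $P(x,\delta n)$. Then the number of $P$-free families in $2^{[n]}$ is $$2^{(h-1+o(1))\binom{n}{\lfloor n/2\rfloor}}\quad (n\to\infty).$$
   Context: Posets are finite collections of finite sets ordered by inclusion. A poset homomorphism $\phi:P\to Q$ is a map with $A\subseteq B\Rightarrow \phi(A)\subseteq\phi(B)$. $P$ is a subposet of $Q$ (and $Q$ ''contains a copy of $P$'') if there is an injective poset homomorphism $P\to Q$; otherwise $Q$ is $P$-free. The Hasse diagram of $P$ is the directed graph on $P$ with an edge $A\to B$ when $A\subsetneq B$ and no $C\in P$ has $A\subsetneq C\subsetneq B$; the undirected Hasse diagram forgets orientations. A tree poset is a poset whose undirected Hasse diagram is a tree. The height $h(P)$ is the number of elements of a longest chain in $P$. For a tree poset $P$, $x\in P$ and an integer $d\ge2$, the $d$-blow-up $P(x,d)$ rooted at $x$ is the tree poset whose Hasse diagram is obtained as follows: each $u\in P$ at distance $\rho$ from $x$ in the undirected Hasse diagram is replaced by $d^{\rho}$ elements $u^1,\dots,u^{d^\rho}$; for each edge $uv$ of the Hasse diagram with $v$ at distance $\rho-1$ from $x$ (and $u$ at distance $\rho$), the $u^i$ are partitioned into $d^{\rho-1}$ disjoint sets $U^1,\dots,U^{d^{\rho-1}}$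 of size $d$ and $v^j$ is joined to every element of $U^j$, with the same orientation as the edge $uv$. Non-integer blow-up parameters such as $\delta n$ are rounded down to integers. *)

(* Defs.v *)
From HB Require Import structures.
From mathcomp Require Import all_boot all_order all_algebra.
From mathcomp Require Import reals exp.
Set Implicit Arguments. Unset Strict Implicit. Unset Printing Implicit Defensive.
Import Order.TTheory GRing.Theory Num.Theory.

(* A poset P is a finite family of subsets of 'I_m ordered by inclusion. *)
Section PosetDefs.
Variable m : nat.
Implicit Types (P : {set {set 'I_m}}) (A B : {set 'I_m}).

Definition hasse P A B : bool :=
  [&& A \in P, B \in P, A \proper B &
      ~~ [exists C in P, (A \proper C) && (C \proper B)]].

Definition uhasse P A B : bool := hasse P A B || hasse P B A.

Definition tree_poset P : Prop :=
  (exists A, A \in P) /\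
  (forall A B, A \in P -> B \in P -> connect (uhasse P) A B) /\
  (forall s : seq {set 'I_m}, uniq s -> 2 < size s -> ~~ cycle (uhasse P) s).

Definition is_chain (C : {set {set 'I_m}}) : bool :=
  [forall A in C, forall B in C, (A \subset B) || (B \subset A)].

Definition height P : nat :=
  \max_(C : {set {set 'I_m}} | (C \subset P) && is_chain C) #|C|.

Definition ball P x (k : nat) : {set {set 'I_m}} :=
  iter k (fun S => S :|: [set B | [exists A in S, uhasse P A B]]) [set x].

Definition dist P x A : nat := find (fun k => A \in ball P x k) (iota 0 #|P|).

(* d-blow-up P(x,d): element u of P at distance rho is replaced by
   u^0, ..., u^(d^rho - 1) *)
Definition bsize P x (d : nat) A : nat := if A \in P then d ^ dist P x A else 0.

Definition blowT P x d := {A : {set 'I_m} & 'I_(bsize P x d A)}.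

(* Hasse edges of the blow-up: for an edge uv of P with u at distance rho and
   v at distance rho-1, v^j is joined to U^j = {u^i | i %/ d = j}, oriented
   as the edge uv. [bup a b] means the edge goes upward from a to b. *)
Definition bup P x d (a b : blowT P x d) : bool :=
  let u := tag a in let v := tag b in
  let i := nat_of_ord (tagged a) in let j := nat_of_ord (tagged b) in
  hasse P u v &&
  (((dist P x u == (dist P x v).+1) && (i %/ d == j)) ||
   ((dist P x v == (dist P x u).+1) && (j %/ d == i))).

Definition ble P x d (a b : blowT P x d) : bool := connect (@bup P x d) a b.

Definition contains_blowup P x d (n : nat) (F : {set {set 'I_n}}) : Prop :=
  exists f : blowT P x d -> {set 'I_n},
    injective f /\ (forall a, f a \in F) /\
    (forall a b, ble a b -> f a \subset f b).

Definition containsb P (n : nat) (F : {set {set 'I_n}}) : bool :=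
  [exists f : {ffun {set 'I_m} -> {set 'I_n}},
    [forall A in P, f A \in F] &&
    [forall A in P, forall B in P,
       ((A != B) ==> (f A != f B)) && ((A \subset B) ==> (f A \subset f B))]].

Definition num_free P (n : nat) : nat :=
  #|[set F : {set {set 'I_n}} | ~~ containsb P F]|.

End PosetDefs.

(* Main.v *)
(* The lower bound counts the subfamilies of the h - 1 middle layers, which
   contain no chain of h sets.  For the upper bound let M(g) be the maximal
   number of P-free subfamilies of a family of size g.  Above the threshold
   (h - 1 + eps / 2) C(n, n/2) a family G contains the blow-up P(x, d) with
   d = delta n, and a P-free F in G either misses the root of the blow-up or
   avoids a whole class of d sibling copies; as there are at most
   K = 2^m d^|P| such classes, M(g) <= M(g - 1) + K M(g - d).  Hence
   M(g) <= 2^((h - 1 + eps / 2) C(n, n/2)) lam^g as soon as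
   lam^(d - 1) + K <= lam^d.  The choice lam = 1 + (eps / 4) C(n, n/2) / 2^n
   makes lam^(2^n) at most 2^((eps / 2) C(n, n/2)), and it satisfies the
   condition for large n because lam - 1 is at least of order n^(-1/2) while d
   is linear in n and K polynomial. *)
Require Import Defs.
From HB Require Import structures.
From mathcomp Require Import all_boot all_order all_algebra.
From mathcomp Require Import reals sequences exp.
From mathcomp Require Import ring lra zify.
Set Implicit Arguments. Unset Strict Implicit. Unset Printing Implicit Defensive.
Import Order.TTheory GRing.Theory Num.Theory.

(** * Distances in tree posets *)

Lemma uhasse_sym m (P : {set {set 'I_m}}) : symmetric (uhasse P).
Proof. by move=> A B; rewrite /uhasse orbC. Qed.

Lemma uhasse_memr m (P : {set {set 'I_m}}) A B : uhasse P A B -> B \in P.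
Proof. by case/orP; case/and4P. Qed.

Lemma uhasse_neq m (P : {set {set 'I_m}}) A B : uhasse P A B -> A != B.
Proof.
by apply: contraTneq => ->; rewrite /uhasse /hasse orbb properxx !andbF.
Qed.

Lemma mem_ballS m (P : {set {set 'I_m}}) x k B :
  (B \in ball P x k.+1) =
  (B \in ball P x k) || [exists A in ball P x k, uhasse P A B].
Proof. by rewrite /ball iterS !inE. Qed.

Lemma ball_le m (P : {set {set 'I_m}}) x j k :
  j <= k -> ball P x j \subset ball P x k.
Proof.
move=> /subnKC <-; elim: (k - j) => [|i IH]; first by rewrite addn0.
by apply: subset_trans IH _; apply/subsetP=> B; rewrite addnS mem_ballS => ->.
Qed.

Lemma path_ball m (P : {set {set 'I_m}}) x s :
  path (uhasse P) x s -> last x s \in ball P x (size s).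
Proof.
elim/last_ind: s => [|s B IH]; first by rewrite inE.
rewrite rcons_path last_rcons size_rcons mem_ballS => /andP[/IH sP sB].
by apply/orP; right; apply/existsP; exists (last x s); rewrite sP.
Qed.

(** [dist] is a [find] in [iota 0 #|P|], so it defaults to [#|P|] on sets that no ball of smaller
    radius reaches; at [k = #|P|] the left side would always hold. *)
Lemma dist_ball m (P : {set {set 'I_m}}) x A k :
  k < #|P| -> (dist P x A <= k) = (A \in ball P x k).
Proof.
move=> kP; apply/idP/idP => [dk | Ak].
  have /(nth_find 0) : has (fun k => A \in ball P x k) (iota 0 #|P|).
    by rewrite has_find size_iota (leq_ltn_trans dk).
  rewrite nth_iota ?add0n; last exact: leq_ltn_trans dk kP.
  exact/subsetP/ball_le.
rewrite leqNgt; apply/negP => /(before_find 0).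
by rewrite nth_iota // add0n Ak.
Qed.

Lemma dist_lt m (P : {set {set 'I_m}}) x A :
  tree_poset P -> x \in P -> A \in P -> dist P x A < #|P|.
Proof.
move=> [_ [conn _]] xP AP.
have /connectP[s sP ->] := conn _ _ xP AP.
case/shortenP: sP => {}s sP us _.
(* A simple path from [x] has at most [#|P|] vertices, hence fewer than [#|P|] edges. *)
have ss : size s < #|P|.
  rewrite -[X in X <= _]/(size (x :: s)) -(card_uniqP us).
  apply: subset_leq_card; apply/subsetP => B; rewrite inE => /predU1P[-> // |].
  elim: s (x) sP {us xP} => // C s IH y /= /andP[yC Cs].
  by rewrite inE => /predU1P[->|/(IH _ Cs)//]; apply: uhasse_memr yC.
by have := path_ball sP; rewrite -dist_ball // => /leq_ltn_trans; apply.
Qed.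

Lemma dist_eq0 m (P : {set {set 'I_m}}) x A :
  x \in P -> (dist P x A == 0) = (A == x).
Proof.
move=> xP; rewrite -leqn0 dist_ball ?inE //.
by apply/card_gt0P; exists x.
Qed.

Lemma dist_uhasse m (P : {set {set 'I_m}}) x A B :
  uhasse P A B -> dist P x B <= (dist P x A).+1.
Proof.
move=> AB; have [dA | dA] := ltnP (dist P x A).+1 #|P|.
  rewrite dist_ball // mem_ballS; apply/orP; right.
  by apply/existsP; exists A; rewrite AB -dist_ball ?leqnn // ltnW.
(* Past the search range, the default value of [find] already bounds [dist P x B]. *)
by apply: leq_trans dA; rewrite -[leqRHS](size_iota 0) find_size.
Qed.

Lemma dist_parent m (P : {set {set 'I_m}}) x A :
  tree_poset P -> x \in P -> A \in P -> A != x ->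
  exists2 B, uhasse P A B & dist P x A = (dist P x B).+1.
Proof.
move=> tP xP AP; rewrite -(dist_eq0 A xP) -lt0n => d0.
have dP := dist_lt tP xP AP.
have: A \in ball P x (dist P x A).-1.+1 by rewrite prednK // -dist_ball.
rewrite mem_ballS -dist_ball ?prednK //; last exact: ltnW.
case/orP=> [|/existsP[B /andP[Bb BA]]]; first by rewrite leqNgt prednK // leqnn.
rewrite -dist_ball in Bb; last by rewrite prednK // ltnW.
exists B; first by rewrite uhasse_sym.
by apply/eqP; rewrite eqn_leq dist_uhasse //= -(prednK d0) ltnS.
Qed.

(* Two such neighbours are joined to [x] by paths avoiding [v], so together
   with [v] they would close a cycle. *)
Lemma parent_unique m (P : {set {set 'I_m}}) x v u w :
  tree_poset P -> x \in P ->
  uhasse P v u -> uhasse P v w ->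
  dist P x u <= dist P x v -> dist P x w <= dist P x v -> u = w.
Proof.
move=> tP xP vu vw du dw; apply/eqP/negPn/negP => uw.
pose e := [rel a b | [&& uhasse P a b, a != v & b != v]].
have es : connect_sym e.
  by apply: sym_connect_sym => a b /=; rewrite uhasse_sym [(a != v) && _]andbC.
(* Moving from [y] to successive parents, the distance to [x] drops strictly below that of [v], so
   the deleted vertex [v] is never met. *)
have toroot k y : y \in P -> dist P x y = k -> k <= dist P x v -> y != v ->
    connect e x y.
  elim: k y => [|k IH] y yP dy kv yv.
    by move/eqP: dy; rewrite dist_eq0 // => /eqP ->.
  have yx : y != x by rewrite -(dist_eq0 y xP) dy.
  have [z yz] := dist_parent tP xP yP yx; rewrite dy => -[dz].
  have zv : z != v by apply: contraTneq kv => <-; rewrite dz ltnn.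
  apply: connect_trans (IH z (uhasse_memr yz) (esym dz) (ltnW kv) zv) _.
  by apply: connect1; rewrite /= uhasse_sym yz zv.
have cuw : connect e u w.
  have nv a : uhasse P v a -> a != v by rewrite eq_sym; apply: uhasse_neq.
  apply: (@connect_trans _ _ x); last first.
    exact: toroot (uhasse_memr vw) erefl dw (nv _ vw).
  rewrite es; exact: toroot (uhasse_memr vu) erefl du (nv _ vu).
case/connectP: cuw uw vw => s0 s0P ->; case/shortenP: s0P => s sP us _ uw vw.
have vs : v \notin u :: s.
  have uv : v != u := uhasse_neq vu.
  rewrite inE (negPf uv) /=; apply/negP.
  elim: s (u) sP {us uw vw} => // a s IH y /= /andP[/and3P[_ _ av] sP].
  by rewrite inE eq_sym (negPf av) /=; apply: IH sP.
have ps : path (uhasse P) u s by apply: sub_path sP => a b /and3P[].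
have sz : 0 < size s by case: s uw {sP us vs ps vw} => //=; rewrite eqxx.
have [_ [_ /(_ (v :: u :: s))]] := tP; rewrite cons_uniq vs us /= => /(_ isT).
by rewrite !ltnS sz vu rcons_path ps uhasse_sym vw => /(_ isT).
Qed.

(** At equal distances, [B] and the parent of [A] would be two distinct neighbours of [A] no farther
    from [x] than [A], against [parent_unique]; if [A = x], then [B] would be [x] too. *)
Lemma dist_uhasse_neq m (P : {set {set 'I_m}}) x A B :
  tree_poset P -> x \in P -> uhasse P A B ->
  (dist P x A == (dist P x B).+1) || (dist P x B == (dist P x A).+1).
Proof.
move=> tP xP AB.
have BA : uhasse P B A by rewrite uhasse_sym.
have dA := dist_uhasse x AB; have dB := dist_uhasse x BA.
have [lt | lt | eq] := ltngtP (dist P x A) (dist P x B).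
- by rewrite (@eqn_leq _ (dist P x A).+1) dA lt orbT.
- by rewrite eqn_leq dB lt.
have [xA | Ax] := eqVneq A x.
  have dx : dist P x x = 0 by apply/eqP; rewrite dist_eq0.
  by have := uhasse_neq AB; rewrite xA eq_sym -(dist_eq0 B xP) -eq xA dx.
have [C AC dC] := dist_parent tP xP (uhasse_memr BA) Ax.
have := parent_unique tP xP AB AC; rewrite -eq leqnn dC leqnSn.
by move=> /(_ isT isT) BC; move: eq; rewrite dC BC; lia.
Qed.

(** Induction on [#|B| - #|A|]: an intermediate element of [P] splits the inclusion into two shorter
    ones, and without one it is a Hasse edge. Monotonicity thus needs checking on edges only. *)
Lemma hasse_ind m (P : {set {set 'I_m}}) (r : {set 'I_m} -> {set 'I_m} -> Prop) :
  (forall A, r A A) -> (forall A B C, r A B -> r B C -> r A C) ->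
  (forall A B, hasse P A B -> r A B) ->
  forall A B, A \in P -> B \in P -> A \subset B -> r A B.
Proof.
move=> r0 rT rH A B; have [k] := ubnP (#|B| - #|A|).
elim: k A B => // k IH A B kAB AP BP; rewrite subEproper => /predU1P[-> // | AB].
have [/existsP[C /and3P[CP AC CB]] | nC] :=
  boolP [exists C in P, (A \proper C) && (C \proper B)].
  have := proper_card AC; have := proper_card CB => cB cA.
  apply: (rT _ C); apply: IH => //; try exact: proper_sub; lia.
by apply: rH; rewrite /hasse AP BP AB nC.
Qed.

(** The indices are chosen level by level away from [x]. Since parents are unique, each new index is
    constrained by a single earlier choice. *)
Lemma tree_select m (P : {set {set 'I_m}}) x (d : nat) (Q : {set 'I_m} -> nat -> bool) :
  tree_poset P -> x \in P -> Q x 0 ->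
  (forall u v i, uhasse P u v -> dist P x v = (dist P x u).+1 -> Q u i ->
     exists2 j, j %/ d = i & Q v j) ->
  exists g : {set 'I_m} -> nat,
    (forall A, A \in P -> Q A (g A)) /\
    (forall A B, uhasse P A B -> dist P x B = (dist P x A).+1 -> g B %/ d = g A).
Proof.
move=> tP xP Qx Qstep.
suff [g [gQ gd]] : exists g : {set 'I_m} -> nat,
    (forall A, A \in P -> dist P x A <= #|P| -> Q A (g A)) /\
    (forall A B, uhasse P A B -> dist P x B = (dist P x A).+1 ->
       dist P x B <= #|P| -> g B %/ d = g A).
  exists g; split=> [A AP | A B AB dB].
    exact: gQ AP (ltnW (dist_lt tP xP AP)).
  exact: gd AB dB (ltnW (dist_lt tP xP (uhasse_memr AB))).
elim: #|P| => [|k [g [gQ gd]]].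
  exists (fun=> 0); split=> [A AP | A B _ ->] //.
  by rewrite leqn0 dist_eq0 // => /eqP ->.
have next B : exists j, B \in P -> dist P x B = k.+1 ->
    Q B j /\ forall A, uhasse P A B -> dist P x B = (dist P x A).+1 -> j %/ d = g A.
  have [BP|] := boolP (B \in P); last by exists 0.
  have [dB|/eqP nd] := eqVneq (dist P x B) k.+1; last by exists 0 => _ /nd.
  have Bx : B != x by rewrite -(dist_eq0 B xP) dB.
  have [A BA dA] := dist_parent tP xP BP Bx.
  have AB : uhasse P A B by rewrite uhasse_sym.
  have QA : Q A (g A).
    by apply: gQ (uhasse_memr BA) _; rewrite -ltnS -dA dB.
  have [j jA jB] := Qstep _ _ _ AB dA QA.
  exists j => _ _; split=> // A' A'B dA'.
  rewrite jA; congr (g _); apply: (parent_unique tP xP BA).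
  - by rewrite uhasse_sym.
  - by rewrite dA.
  - by rewrite dA'.
have [g' g'P] := fin_all_exists next.
exists (fun B => if dist P x B == k.+1 then g' B else g B); split=> [A AP|A B AB dB].
  case: eqP => [dA _|/eqP dA dk]; first by case: (g'P A AP dA).
  by apply: gQ => //; rewrite -ltnS ltn_neqAle dA.
have [dk _|dk dk1] := eqVneq (dist P x B) k.+1.
  rewrite ifF; last by apply/eqP; lia.
  by case: (g'P B (uhasse_memr AB) dk) => _; apply.
rewrite ifF; last by apply/eqP; lia.
by apply: gd => //; lia.
Qed.

(** * Copies of [P] in a blow-up *)

(* The junk value [set0] is taken when [j] is not the index of a copy of [A]. *)
Definition blow_at m (P : {set {set 'I_m}}) x d n
    (f : blowT P x d -> {set 'I_n}) (A : {set 'I_m}) (j : nat) : {set 'I_n} :=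
  if (insub j : option 'I_(bsize P x d A)) is Some i
  then f (existT _ A i) else set0.

(* The copies of [v] attached to the [i]-th copy of the parent of [v]. *)
Definition siblings m (P : {set {set 'I_m}}) x d n
    (f : blowT P x d -> {set 'I_n}) (v : {set 'I_m}) (i : nat) :=
  [set blow_at f v (i * d + k) | k : 'I_d].

Lemma blow_atE m (P : {set {set 'I_m}}) x d n (f : blowT P x d -> {set 'I_n})
    A j :
  A \in P -> j < d ^ dist P x A ->
  exists2 i : 'I_(bsize P x d A), val i = j & blow_at f A j = f (existT _ A i).
Proof.
move=> AP jd; have jb : j < bsize P x d A by rewrite /bsize AP.
by exists (Ordinal jb); rewrite // /blow_at insubT.
Qed.

Lemma blow_at_inj m (P : {set {set 'I_m}}) x d n (f : blowT P x d -> {set 'I_n})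
    A B i j :
  injective f -> A \in P -> B \in P ->
  i < d ^ dist P x A -> j < d ^ dist P x B ->
  blow_at f A i = blow_at f B j -> A = B /\ i = j.
Proof.
move=> fI AP BP /(blow_atE f AP)[i' <- ->] /(blow_atE f BP)[j' <- ->] /fI E.
split; first exact: (congr1 tag E).
exact: (congr1 (fun b : blowT P x d => nat_of_ord (tagged b)) E).
Qed.

Lemma sibling_lt d r i k : k < d -> i < d ^ r -> i * d + k < d ^ r.+1.
Proof.
move=> kd ir; apply: (@leq_trans (i.+1 * d)); first by rewrite mulSn; lia.
by rewrite expnSr leq_pmul2r //; lia.
Qed.

Lemma card_siblings m (P : {set {set 'I_m}}) x d n
    (f : blowT P x d -> {set 'I_n}) v i r :
  injective f -> v \in P -> dist P x v = r.+1 -> i < d ^ r ->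
  #|siblings f v i| = d.
Proof.
move=> fI vP dv ir; rewrite card_imset ?card_ord // => k l.
case/(blow_at_inj fI vP vP); rewrite ?dv ?sibling_lt // => _ kl.
by apply: val_inj => /=; lia.
Qed.

(* Otherwise one selects greedily, going away from [x], one copy in [F] of each
   element of [P], each below or above the selected copy of its parent. *)
Lemma free_avoids_siblings m (P : {set {set 'I_m}}) x d n
    (f : blowT P x d -> {set 'I_n}) (F : {set {set 'I_n}}) :
  tree_poset P -> x \in P -> injective f ->
  (forall a b, ble a b -> f a \subset f b) -> ~~ containsb P F ->
  blow_at f x 0 \in F ->
  exists v i r, [/\ v \in P, dist P x v = r.+1, i < d ^ r
    & [disjoint siblings f v i & F]].
Proof.
move=> tP xP fI fle freeF x0F.
have [/existsP[v]|none] := boolP [exists v in P,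
    [exists i : 'I_(d ^ (dist P x v).-1),
      (0 < dist P x v) && [disjoint siblings f v i & F]]].
  case/andP=> vP /existsP[i /andP[dv vF]].
  by exists v, i, (dist P x v).-1; rewrite prednK.
pose Q A j := (j < d ^ dist P x A) && (blow_at f A j \in F).
have Qx : Q x 0.
  by rewrite /Q x0F andbT; have /eqP -> : dist P x x == 0 by rewrite dist_eq0.
have [|g [gQ gd]] := @tree_select m P x d Q tP xP Qx.
  move=> u v i uv dv /andP[iu uF].
  have: ~~ [disjoint siblings f v i & F].
    apply: contra none => vF; apply/existsP; exists v.
    rewrite (uhasse_memr uv); apply/existsP.
    have iv : i < d ^ (dist P x v).-1 by rewrite dv.
    by exists (Ordinal iv); rewrite vF andbT dv.
  case/pred0Pn => Y /andP[/imsetP[k _ ->] YF]; exists (i * d + k).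
    by rewrite divnMDl ?divn_small ?addn0 // (leq_ltn_trans _ (ltn_ord k)).
  by apply/andP; split; [rewrite dv sibling_lt | apply: YF].
have glt A : A \in P -> g A < d ^ dist P x A by case/gQ/andP.
case/negP: freeF; apply/existsP; exists [ffun A => blow_at f A (g A)].
apply/andP; split.
  by apply/forallP=> A; apply/implyP=> AP; rewrite ffunE; case/andP: (gQ A AP).
apply/forallP=> A; apply/implyP=> AP; apply/forallP=> B; apply/implyP=> BP.
rewrite !ffunE; apply/andP; split; apply/implyP.
  by apply: contra_neq => /(blow_at_inj fI AP BP (glt A AP) (glt B BP))[].
pose r A B := blow_at f A (g A) \subset blow_at f B (g B).
apply: (@hasse_ind _ P r) AP BP => {A B} [A | A B C | A B AB].
- exact: subxx.
- exact: subset_trans.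
rewrite /r.
have uAB : uhasse P A B by rewrite /uhasse AB.
have uBA : uhasse P B A by rewrite uhasse_sym.
have AP := uhasse_memr uBA; have BP := uhasse_memr uAB.
have [i iE ->] := blow_atE f AP (glt A AP).
have [j jE ->] := blow_atE f BP (glt B BP).
apply/fle/connect1; rewrite /bup /= AB /= iE jE.
(* The endpoint farther from [x] decides which alternative in [bup] applies. *)
by case/orP: (dist_uhasse_neq tP xP uAB) => /eqP dE;
  rewrite dE eqxx (gd _ _ _ dE) ?eqxx // orbT.
Qed.

(** * Counting and asymptotics *)

Local Open Scope ring_scope.

(* In a set [G] above the threshold, a free [F] either misses [y] or avoids one
   of the [D k]; hence the count satisfies the recurrence
   [M g <= M (g - 1) + #|I| * M (g - d)]. *)
Lemma card_free_subsets (R : realType) (T I : finType) (free : pred {set T})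
    (d : nat) (lam T0 : R) :
  1 <= lam -> lam ^+ d + #|I|%:R <= lam ^+ d.+1 ->
  (forall G : {set T}, T0 <= #|G|%:R ->
     exists y (D : I -> {set T}), y \in G /\
       forall F : {set T}, F \subset G -> free F -> y \in F ->
         exists k, [/\ D k \subset G, #|D k| = d.+1 & [disjoint D k & F]]) ->
  forall G : {set T},
    #|[set F : {set T} | (F \subset G) && free F]|%:R <= 2 `^ T0 * lam ^+ #|G|.
Proof.
move=> lam1 lamd step G; have [g] := ubnP #|G|.
have lam0 : 0 <= lam by apply: le_trans lam1.
have A0 : 0 <= 2 `^ T0 :> R by apply: powR_ge0.
elim: g G => // g IH G; rewrite ltnS => Gg.
pose S (H : {set T}) := [set F : {set T} | (F \subset H) && free F].
rewrite -/(S G).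
(* Below the threshold, counting all subsets of [G] suffices. *)
have [small | large] := ltP (#|G|%:R) T0.
  apply: (@le_trans _ _ (2 `^ T0)); last by rewrite ler_peMr // exprn_ege1.
  apply: (@le_trans _ _ (2 `^ (#|G|%:R))).
    rewrite powR_mulrn // -natrX ler_nat -card_powerset; apply/subset_leq_card.
    by apply/subsetP=> F; rewrite !inE => /andP[].
  by apply: ler_powR (ltW small); rewrite ler1n.
have [y [D [yG Dfree]]] := step G large.
(* Other indices are discarded, so that the induction hypothesis gives the same bound for every
   remaining [G :\: D k]. *)
pose ok k := (D k \subset G) && (#|D k| == d.+1).
have SG : S G \subset S (G :\ y) :|: \bigcup_(k | ok k) S (G :\: D k).
  apply/subsetP=> F; rewrite !inE => /andP[FG Ffree].
  have [yF|yF] := boolP (y \in F); last by rewrite subsetD1 FG Ffree yF.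
  have [k [DG Dd DF]] := Dfree F FG Ffree yF.
  apply/orP; right; apply/bigcupP; exists k; first by rewrite /ok DG Dd eqxx.
  by rewrite inE subsetD FG Ffree disjoint_sym DF.
have cU : (#|S G| <= #|S (G :\ y)| + \sum_(k | ok k) #|S (G :\: D k)|)%N.
  apply: leq_trans (subset_leq_card SG) _.
  apply: leq_trans (leq_card_setU _ _) _; rewrite leq_add2l.
  elim/big_rec2: _ => [|k n A _ nA]; first by rewrite cards0.
  by apply: leq_trans (leq_card_setU _ _) _; rewrite leq_add2l.
have Gy : #|G| = #|G :\ y|.+1 by rewrite (cardsD1 y G) yG.
have IHy : #|S (G :\ y)|%:R <= 2 `^ T0 * lam ^+ #|G|.-1.
  by rewrite Gy; apply: IH; rewrite -Gy.
have IHD k : ok k -> #|S (G :\: D k)|%:R <= 2 `^ T0 * lam ^+ (#|G| - d.+1).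
  case/andP=> DG /eqP Dd.
  have cD : #|G :\: D k| = (#|G| - d.+1)%N.
    by rewrite cardsD (setIidPr DG) Dd.
  by rewrite -cD; apply: IH; rewrite cD; lia.
(* If [G] is large enough, the condition on [lam] multiplied by [lam ^+ (#|G| - d.+1)] closes the
   recurrence. *)
have [dG | Gd] := leqP d.+1 #|G|.
  apply: (@le_trans _ _ (2 `^ T0 * lam ^+ #|G|.-1 +
      #|I|%:R * (2 `^ T0 * lam ^+ (#|G| - d.+1)))).
    apply: (@le_trans _ _ (#|S (G :\ y)| + \sum_(k | ok k) #|S (G :\: D k)|)%:R).
      by rewrite ler_nat.
    rewrite natrD natr_sum lerD //; apply: (le_trans (ler_sum _ IHD)).
    rewrite sumr_const -[leLHS]mulr_natl ler_wpM2r ?mulr_ge0 ?exprn_ge0 //.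
    by rewrite ler_nat max_card.
  have -> : #|G|.-1 = (#|G| - d.+1 + d)%N by lia.
  have -> : lam ^+ #|G| = lam ^+ (#|G| - d.+1) * lam ^+ d.+1.
    by rewrite -exprD subnK.
  rewrite exprD; set L := lam ^+ (_ - _).
  have -> : 2 `^ T0 * (L * lam ^+ d) + #|I|%:R * (2 `^ T0 * L) =
            2 `^ T0 * L * (lam ^+ d + #|I|%:R) by ring.
  by rewrite mulrA ler_wpM2l // mulr_ge0 // exprn_ge0.
(* A smaller [G] contains no set of size [d.+1], so only the term for [G :\ y] remains. *)
apply: (@le_trans _ _ (2 `^ T0 * lam ^+ #|G|.-1)); last first.
  by rewrite ler_wpM2l // ler_weXn2l // leq_pred.
apply: le_trans IHy; rewrite ler_nat; apply: leq_trans cU _.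
rewrite big_pred0 ?addn0 // => k; apply: contraTF Gd => /andP[DG /eqP Dd].
by rewrite -leqNgt -Dd subset_leq_card.
Qed.

(** * Binomial and exponential estimates for the recurrence *)

Lemma bernoulli_ineq (R : realDomainType) (t : R) (n : nat) :
  0 <= t -> n%:R * t <= (1 + t) ^+ n.
Proof.
move=> t0; suff: 1 + n%:R * t <= (1 + t) ^+ n by apply: le_trans; lra.
elim: n => [|n IH]; first by rewrite mul0r addr0.
rewrite exprS -natr1; have : 0 <= n%:R * t by rewrite mulr_ge0.
have : (1 + t) * (1 + n%:R * t) <= (1 + t) * (1 + t) ^+ n.
  by rewrite ler_wpM2l //; lra.
by move=> + nt; apply: le_trans; nra.
Qed.

Lemma central_bin_step k :
  'C(k.+1.*2, k.+1) = (2 * 'C(k.*2.+1, k))%N /\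
  (k.+1 * 'C(k.*2.+1, k) = k.*2.+1 * 'C(k.*2, k))%N.
Proof.
split; last by rewrite (mul_bin_down k.*2.+1 k) subSn -?addnn ?addnK ?leq_addr.
apply/eqP; rewrite -(eqn_pmul2l (ltn0Sn k)) -mul_bin_diag doubleS /=.
by rewrite mulnA muln2 doubleS.
Qed.

(** This is C(2k, k) >= 4^k / (2 sqrt k), squared. The induction step reduces to 4k(k + 1) <= (2k +
    1)^2. *)
Lemma central_bin_lower k : (0 < k)%N -> (16 ^ k <= 4 * k * 'C(k.*2, k) ^ 2)%N.
Proof.
case: k => // k _; elim: k => // k IH.
have [c2 bk] := central_bin_step k.+1.
rewrite -(leq_pmul2l (ltn0Sn k.+1)) c2.
have -> : (k.+2 * (4 * k.+2 * (2 * 'C(k.+1.*2.+1, k.+1)) ^ 2) =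
           16 * (k.+2 * 'C(k.+1.*2.+1, k.+1)) ^ 2)%N by ring.
rewrite bk expnS; have -> : (k.+1.*2.+1 = 2 * k.+1 + 1)%N by lia.
apply: (@leq_trans (k.+2 * (16 * (4 * k.+1 * 'C(k.+1.*2, k.+1) ^ 2)))).
  by rewrite leq_pmul2l // leq_pmul2l.
rewrite expnMn; set a := (_ ^ 2)%N; nia.
Qed.

(** Makes C(n, n/2) / 2^n at least of order n^(-1/2). For odd [n], the coefficient is half of the
    next central one. *)
Lemma bin_half_lower n : (4 ^ n <= 2 * n.+1 * 'C(n, n./2) ^ 2)%N.
Proof.
have := odd_double_half n; set k := n./2; case: (odd n) => /= <-.
  have [c2 _] := central_bin_step k; have := central_bin_lower (ltn0Sn k).
  rewrite c2 add1n; have -> : (16 ^ k.+1 = 4 * 4 ^ k.*2.+1)%N.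
    by rewrite -expnS -[16%N]/(4 ^ 2)%N -expnM; congr expn; lia.
  by rewrite expnMn -mul2n; set a := (_ ^ 2)%N; nia.
rewrite add0n; case: (posnP k) => [-> // | k0].
have -> : (4 ^ k.*2 = 16 ^ k)%N by rewrite -mul2n expnM.
by apply: leq_trans (central_bin_lower k0) _; rewrite -mul2n; nia.
Qed.

Lemma truncnS_le (R : realType) (x : R) (n : nat) :
  ((Num.truncn x).+1 <= n)%N -> x < n%:R.
Proof. by rewrite -(ler_nat R); apply: lt_le_trans; apply: truncnS_gt. Qed.

(** The claim amounts to c d^p <= t (1 + t)^(d-1). With K = 2(p + 2) and q = (d-1) / K rounded down,
    Bernoulli gives (1 + t)^(d-1) >= (q t)^K. As q is linear in n and t^2 at least of order 1/n,
    this has order at least n^(p+2); the lone factor t costs at most one power of n, which leaves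
    n^(p+1) against n^p. *)
Lemma growth_condition (R : realType) (delta e : R) (c p : nat) :
  0 < delta -> 0 < e ->
  exists N : nat, forall n, (N <= n)%N -> forall (t : R),
    0 <= t -> e / (2 * n.+1%:R) <= t -> e ^+ 2 / (2 * n.+1%:R) <= t ^+ 2 ->
    let d := Num.truncn (delta * n%:R) in
    (0 < d)%N /\ (1 + t) ^+ d.-1 + (c * d ^ p)%:R <= (1 + t) ^+ d.
Proof.
move=> delta0 e0; have [K KE] : {K | K = (2 * p.+2)%N} by exists (2 * p.+2)%N.
have K0 : 0 < K%:R :> R by rewrite KE ltr0n.
pose a := delta / (2 * K%:R).
have a0 : 0 < a by rewrite divr_gt0 // mulr_gt0.
pose c1 := a ^+ 2 * e ^+ 2 / 4.
have c10 : 0 < c1 by rewrite divr_gt0 // mulr_gt0 ?exprn_gt0.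
(* [X1] makes [d] large enough for [q >= a * n] despite both roundings; [X2] settles the final
   comparison of coefficients. *)
pose X1 := 2 * (1 + K%:R) / delta.
pose X2 := 4 * c%:R * delta ^+ p / (e * c1 ^+ p.+2).
have cp0 : 0 < e * c1 ^+ p.+2 by rewrite mulr_gt0 // exprn_gt0.
have X10 : 0 <= X1 by rewrite divr_ge0 ?mulr_ge0 ?addr_ge0 // ltW.
have X20 : 0 <= X2.
  by rewrite divr_ge0 ?(ltW cp0) // !mulr_ge0 // exprn_ge0 // ltW.
exists (Num.truncn (1 + X1 + X2)).+1 => n /truncnS_le nX t t0 te t2 d.
have n1 : 1 < n%:R :> R by lra.
have dn : 2 * (1 + K%:R) <= delta * n%:R.
  by rewrite [leRHS]mulrC -ler_pdivrMr // -/X1; lra.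
have dn0 : 0 <= delta * n%:R by lra.
have /andP[dle dgt] := truncn_itv dn0; rewrite -/d in dle dgt.
have d0 : (0 < d)%N by rewrite truncn_gt0; lra.
split=> //; pose q := (d.-1 %/ K)%N.
have qK : (q * K <= d.-1)%N by apply: leq_divM.
have dq : (d <= q.+1 * K)%N.
  by rewrite -(prednK d0) ltn_ceil // KE.
have aq : a * n%:R <= q%:R.
  have : d%:R <= (q.+1 * K)%:R :> R by rewrite ler_nat.
  rewrite natrM -natr1 => dq'.
  have -> : a * n%:R = delta * n%:R / (2 * K%:R) by rewrite /a; ring.
  rewrite ler_pdivrMr ?mulr_gt0 //; rewrite -natr1 in dgt; nra.
have qt : c1 * n%:R <= (q%:R * t) ^+ 2.
  rewrite exprMn; apply: (@le_trans _ _ ((a * n%:R) ^+ 2 * (e ^+ 2 / (2 * n.+1%:R)))).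
    rewrite [(a * _) ^+ 2]exprMn /c1 -[n.+1%:R]natr1; set N := n%:R in n1 *.
    rewrite [leRHS]mulrA ler_pdivlMr; last by lra.
    have -> : a ^+ 2 * e ^+ 2 / 4 * N * (2 * (N + 1)) =
      a ^+ 2 * e ^+ 2 * N * ((N + 1) / 2) by field.
    have -> : a ^+ 2 * N ^+ 2 * e ^+ 2 = a ^+ 2 * e ^+ 2 * N * N by ring.
    apply: ler_wpM2l; last by lra.
    by apply: mulr_ge0; [apply: mulr_ge0; apply: sqr_ge0 | lra].
  rewrite ler_pM ?sqr_ge0 ?divr_ge0 ?sqr_ge0 ?mulr_ge0 //.
  have an : 0 <= a * n%:R by apply: mulr_ge0 => //; apply: ltW.
  by rewrite lerXn2r ?nnegrE // (le_trans an).
have c1n : 0 <= c1 * n%:R by apply: mulr_ge0 => //; apply: ltW.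
have W : (c1 * n%:R) ^+ p.+2 <= (1 + t) ^+ d.-1.
  apply: (@le_trans _ _ ((1 + t) ^+ (q * K))); last first.
    by rewrite ler_weXn2l //; lra.
  rewrite exprM; apply: (@le_trans _ _ ((q%:R * t) ^+ K)); last first.
    rewrite lerXn2r ?nnegrE ?mulr_ge0 ?exprn_ge0 ?bernoulli_ineq //; lra.
  by rewrite KE exprM lerXn2r ?nnegrE ?sqr_ge0.
have te' : e / (4 * n%:R) <= t.
  apply: le_trans te; rewrite -[n.+1%:R]natr1 ler_wpM2l ?(ltW e0) //.
  by rewrite lef_pV2 ?posrE; lra.
have -> : (1 + t) ^+ d = (1 + t) ^+ d.-1 + t * (1 + t) ^+ d.-1.
  by rewrite -{1}(prednK d0) exprS mulrDl mul1r.
rewrite lerD2l; apply: (@le_trans _ _ (e / (4 * n%:R) * (c1 * n%:R) ^+ p.+2)).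
  have -> : e / (4 * n%:R) * (c1 * n%:R) ^+ p.+2 =
      e * c1 ^+ p.+2 / 4 * n%:R * n%:R ^+ p.
    by rewrite exprMn 2!(exprS n%:R); field; lra.
  rewrite natrM natrX; apply: (@le_trans _ _ (c%:R * (delta * n%:R) ^+ p)).
    by rewrite ler_wpM2l // lerXn2r ?nnegrE.
  rewrite exprMn mulrA ler_wpM2r ?exprn_ge0 //.
  have : X2 <= n%:R by lra.
  by rewrite /X2 ler_pdivrMr //; lra.
by rewrite ler_pM ?exprn_ge0 // divr_ge0 ?(ltW e0) // mulr_ge0.
Qed.

(** * Middle layers and the lower bound *)

Lemma near_middle_bin (R : realType) (i : nat) (eta : R) : 0 < eta ->
  exists N : nat, forall n, (N <= n)%N ->
    (1 - eta) * 'C(n, n./2)%:R <= 'C(n, n./2 + i)%:R.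
Proof.
elim: i eta => [|i IH] eta eta0.
  by exists 0%N => n _; rewrite addn0 ler_piMl //; lra.
have [eta1 | eta1] := leP 1 eta.
  by exists 0%N => n _; apply: (@le_trans _ _ 0) => //; rewrite mulr_le0_ge0 //; lra.
have eta2 : 0 < eta / 2 by lra.
have [N NP] := IH _ eta2.
(* With k = n/2 rounded down, the ratio of consecutive coefficients is at least (k - i) / (k + i +
   1) = 1 - (2i + 1) / (k + i + 1); this threshold keeps the loss below [eta / 2]. *)
exists (maxn N (Num.truncn (2 * (2 * i%:R + 1) / eta)).+1.*2.+1) => n.
rewrite geq_max => /andP[/NP IHn n2].
have /truncnS_le : ((Num.truncn (2 * (2 * i%:R + 1) / eta)).+1 <= n./2)%N by lia.
rewrite ltr_pdivrMr // => nbig.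
have ki : i%:R < n./2%:R :> R.
  have i0 : 0 <= i%:R :> R by [].
  have k0 : 0 <= n./2%:R :> R by [].
  nra.
rewrite ltr_nat in ki.
have /(congr1 (fun k => k%:R : R)) := mul_bin_left n (n./2 + i).
rewrite /= !natrM => step.
have : n./2%:R - i%:R <= (n - (n./2 + i))%:R :> R.
  by rewrite -natrB ?ler_nat; lia.
move: step nbig; rewrite addnS -addn1 !natrD.
set b := ('C(n, n./2 + i)%:R : R) in IHn *; set k := n./2%:R; set C := 'C(n, n./2)%:R in IHn *.
set w := (n - _)%:R; set b' := 'C(_, _)%:R => step nbig kw.
have b0 : 0 <= b by rewrite /b.
have C0 : 0 <= C by rewrite /C.
have i0 : 0 <= i%:R :> R by [].
have k0 : 0 <= k by rewrite /k.
have s0 : 0 < k + i%:R + 1 by lra.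
have : (k + i%:R + 1) * ((1 - eta / 2) * b) <= (k + i%:R + 1) * b'.
  by rewrite step mulrA ler_wpM2r //; nra.
rewrite ler_pM2l // => bb'; nra.
Qed.

(** The layers start at the middle one instead of being centred on it, which for fixed [k] changes
    the size only by o(1) C(n, n/2). *)
Definition middle_layers (n k : nat) : {set {set 'I_n}} :=
  [set A : {set 'I_n} | (n./2 <= #|A| < n./2 + k)%N].

Lemma card_middle_layers (R : realType) (k : nat) (eta : R) : 0 < eta ->
  exists N : nat, forall n, (N <= n)%N ->
    (k%:R - eta) * 'C(n, n./2)%:R <= #|middle_layers n k|%:R.
Proof.
elim: k eta => [|k IH] eta eta0.
  by exists 0%N => n _; apply: (@le_trans _ _ 0) => //; rewrite mulr_le0_ge0 //; lra.
have eta2 : 0 < eta / 2 by lra.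
have [[N1 N1P] [N2 N2P]] := (IH _ eta2, near_middle_bin k eta2).
exists (maxn N1 N2) => n; rewrite geq_max => /andP[/N1P b1 /N2P b2].
have -> : #|middle_layers n k.+1| = (#|middle_layers n k| + 'C(n, n./2 + k))%N.
  have := card_draws 'I_n (n./2 + k); rewrite card_ord => <-.
  rewrite -cardsUI (_ : _ :&: _ = set0) ?cards0 ?addn0.
    by apply: eq_card => A; rewrite !inE; lia.
  by apply/setP=> A; rewrite !inE; apply/negP; lia.
by rewrite natrD -natr1; lra.
Qed.

(* A chain of the copy consists of sets of distinct sizes. *)
Lemma height_middle_layers m (P : {set {set 'I_m}}) n k (F : {set {set 'I_n}}) :
  F \subset middle_layers n k -> containsb P F -> (height P <= k)%N.
Proof.
move=> /subsetP FL /existsP[f /andP[/forallP fF /forallP fP]].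
apply/bigmax_leqP => C /andP[/subsetP CP /forallP chC].
pose s A := (#|f A|)%N.
have sI : {in C &, injective s}.
  move=> A B AC BC sAB; apply/eqP; apply: contraT => AB.
  have fAB U V : U \in C -> V \in C -> U != V -> U \subset V ->
      (s U < s V)%N.
    move=> UC VC UV sUV.
    have := implyP (fP U) (CP _ UC) => /forallP/(_ V)/implyP/(_ (CP _ VC)).
    case/andP => /implyP/(_ UV) fUV /implyP/(_ sUV) fsub.
    by apply: proper_card; rewrite properEneq fUV.
  have := implyP (chC A) AC => /forallP/(_ B)/implyP/(_ BC).
  case/orP=> [/(fAB _ _ AC BC AB) | /(fAB _ _ BC AC)].
    by rewrite sAB ltnn.
  by rewrite eq_sym sAB ltnn => /(_ AB).
(* The sizes are distinct and lie in an interval of [k] integers. *)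
rewrite cardE -(size_map s) -(size_iota n./2 k); apply: uniq_leq_size.
  rewrite map_inj_in_uniq ?enum_uniq // => A B; rewrite !mem_enum; exact: sI.
move=> j /mapP[A]; rewrite mem_enum => AC ->; rewrite mem_iota.
by have := FL _ (implyP (fF A) (CP _ AC)); rewrite inE.
Qed.

Lemma num_free_lower m (P : {set {set 'I_m}}) n k :
  (k < height P)%N -> (2 ^ #|middle_layers n k| <= num_free P n)%N.
Proof.
move=> kP; rewrite -card_powerset; apply/subset_leq_card/subsetP => F.
rewrite !inE => FL; apply: contraL kP => /(height_middle_layers FL).
by rewrite leqNgt.
Qed.

Lemma height_gt0 m (P : {set {set 'I_m}}) x : x \in P -> (0 < height P)%N.
Proof.
move=> xP; rewrite -(cards1 x); apply: (@leq_bigmax_cond _ _ (fun C => #|pred_of_set C|)).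
rewrite sub1set xP; apply/forallP=> A; apply/implyP; rewrite inE => /eqP->.
by apply/forallP=> B; apply/implyP; rewrite inE => /eqP->; rewrite subxx.
Qed.

(** * Upper bound and conclusion *)

Lemma expR_le_pow2 (R : realType) (x : R) : 0 <= x -> expR x <= 2 `^ (2 * x).
Proof.
move=> x0; rewrite {1}(_ : x = 2^-1 * (2 * x)); last by field.
rewrite expRM ge0_ler_powR ?nnegrE ?expR_ge0 //.
  by rewrite mulr_ge0.
(* From exp(-1/2) >= 1 - 1/2 follows exp(1/2) <= 2. *)
have := expR_ge1Dx (- 2^-1 : R); rewrite expRN => h.
have : 2^-1 <= (expR (2^-1 : R))^-1 by lra.
by rewrite lef_pV2 ?posrE ?expR_gt0.
Qed.

(* The elements [y] and [D] of the recurrence are the root of a blow-up found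
   in [G] and its classes of siblings. *)
Lemma blowup_step m (P : {set {set 'I_m}}) x d n (G : {set {set 'I_n}}) :
  tree_poset P -> x \in P -> (0 < d)%N -> contains_blowup P x d G ->
  exists y (D : {set 'I_m} * 'I_(d ^ #|P|) -> {set {set 'I_n}}), y \in G /\
    forall F : {set {set 'I_n}}, F \subset G -> ~~ containsb P F -> y \in F ->
      exists k, [/\ D k \subset G, #|D k| = d & [disjoint D k & F]].
Proof.
move=> tP xP d0 [f [fI [fG fle]]].
have bG A j : A \in P -> (j < d ^ dist P x A)%N -> blow_at f A j \in G.
  by move=> AP /(blow_atE f AP)[i _ ->].
(* A class is indexed by its element and the copy of the parent; [d ^ #|P|] bounds the number of
   copies uniformly. Pairs naming no class are harmless, since the conclusion concerns one chosen
   index. *)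
exists (blow_at f x 0), (fun k : _ * 'I_(d ^ #|P|) => siblings f k.1 k.2).
split=> [|F FG freeF x0F]; first by rewrite bG // expn_gt0 d0.
have [v [i [r [vP dv ir vF]]]] := free_avoids_siblings tP xP fI fle freeF x0F.
have iP : (i < d ^ #|P|)%N.
  by apply: leq_trans ir _; rewrite leq_pexp2l // ltnW // -dv ltnW // dist_lt.
exists (v, Ordinal iP); split=> //=; last exact: card_siblings dv ir.
by apply/subsetP=> Y /imsetP[k _ ->]; rewrite bG // dv sibling_lt.
Qed.

Theorem theorem1p6 (R : realType) (m : nat) (P : {set {set 'I_m}})
    (x : {set 'I_m}) :
  tree_poset P -> x \in P ->
  (forall eps : R, 0 < eps ->
     exists2 delta : R, 0 < delta &
       exists N : nat, forall n : nat, (N <= n)%N ->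
         forall F : {set {set 'I_n}},
           ((height P)%:R - 1 + eps) * ('C(n, n./2))%:R <= (#|F|)%:R ->
           contains_blowup P x (Num.truncn (delta * n%:R)) F) ->
  forall eps : R, 0 < eps ->
    exists N : nat, forall n : nat, (N <= n)%N ->
      (2 : R) `^ (((height P)%:R - 1 - eps) * ('C(n, n./2))%:R)
        <= (num_free P n)%:R
      <= (2 : R) `^ (((height P)%:R - 1 + eps) * ('C(n, n./2))%:R).
Proof.
move=> tP xP blow eps eps0.
have hP := height_gt0 xP.
have [N0 N0P] := card_middle_layers (height P).-1 eps0.
have eps2 : 0 < eps / 2 by lra.
have epsE : (height P)%:R - 1 + eps / 2 + eps / 2 = (height P)%:R - 1 + eps by lra.
(* Half of [eps] goes to the threshold, the other half to the factor [lam ^+ (2 ^ n)]. *)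
have [delta delta0 [N1 N1P]] := blow _ eps2.
have e0 : 0 < eps / 4 by lra.
have [N2 N2P] := growth_condition (2 ^ m) #|P| delta0 e0.
exists (maxn N0 (maxn N1 N2)) => n; rewrite !geq_max => /and3P[/N0P lay /N1P blown /N2P grow].
apply/andP; split.
  apply: (@le_trans _ _ (2 `^ (#|middle_layers n (height P).-1|%:R))).
    apply: ler_powR; first by rewrite ler1n.
    by move: lay; rewrite -subn1 natrB.
  by rewrite powR_mulrn // -natrX ler_nat num_free_lower // prednK.
set C : R := 'C(n, n./2)%:R in blown *.
have C0 : 0 <= C by rewrite /C.
have p0 : 0 < 2 ^+ n :> R by rewrite exprn_gt0.
(* The constant comes from (1 + t)^(2^n) <= exp(2^n t) <= 2^(2 * 2^n t), whose last exponent is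
   [eps / 2 * C]. *)
pose t := eps / 4 * (C / 2 ^+ n).
have b0 : 0 <= C / 2 ^+ n by rewrite divr_ge0 // ltW.
have t0 : 0 <= t by rewrite mulr_ge0 // ltW.
have n0 : 0 < 2 * n.+1%:R :> R by rewrite mulr_gt0 // ltr0n.
have b2 : (2 * n.+1%:R)^-1 <= (C / 2 ^+ n) ^+ 2.
  have := bin_half_lower n; rewrite -(ler_nat R) natrM natrX natrM natrX -/C => cb.
  rewrite expr_div_n ler_pdivlMr ?exprn_gt0 // mulrC ler_pdivrMr //.
  by rewrite -exprM mulnC exprM [leRHS]mulrC; apply: le_trans cb; rewrite expr2 -natrM.
(* Since [C / 2 ^+ n] is at most 1, it dominates its square. *)
have b1 : (2 * n.+1%:R)^-1 <= C / 2 ^+ n.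
  apply: (le_trans b2); rewrite expr2 ler_piMr // ler_pdivrMr // mul1r.
  rewrite /C -natrX ler_nat -{1}[n]card_ord -card_draws -[n in (2 ^ n)%N]card_ord.
  by rewrite -cardsT -card_powerset; apply/subset_leq_card/subsetP=> A _; rewrite inE subsetT.
have [||d0 grows] := grow t t0.
- by rewrite /t ler_wpM2l // ltW.
- by rewrite [leRHS]exprMn ler_wpM2l // sqr_ge0.
set d := Num.truncn _ in blown d0 grows.
pose I := ({set 'I_m} * 'I_(d ^ #|P|))%type.
have cI : #|{: I}| = (2 ^ m * d ^ #|P|)%N.
  by rewrite card_prod card_ord -cardsT -powersetT card_powerset cardsT card_ord.
pose T0 := ((height P)%:R - 1 + eps / 2) * C.
(* The counting lemma takes classes of size [d.+1], hence its use with [d.-1]. *)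
have step (G : {set {set 'I_n}}) : T0 <= #|G|%:R ->
    exists y (D : I -> {set {set 'I_n}}), y \in G /\
    forall F : {set {set 'I_n}}, F \subset G -> ~~ containsb P F -> y \in F ->
      exists k, [/\ D k \subset G, #|D k| = d.-1.+1 & [disjoint D k & F]].
  by rewrite prednK // => /blown; apply: blowup_step.
have growI : (1 + t) ^+ d.-1 + #|{: I}|%:R <= (1 + t) ^+ d.-1.+1.
  by rewrite cI prednK.
have lam1 : 1 <= 1 + t by rewrite lerDl.
have cT : #|[set: {set 'I_n}]| = (2 ^ n)%N.
  by rewrite -powersetT card_powerset cardsT card_ord.
have := @card_free_subsets R {set 'I_n} I (fun F => ~~ containsb P F) d.-1
  (1 + t) T0 lam1 growI step [set: {set 'I_n}].
rewrite cT (_ : [set F | _] = [set F | ~~ containsb P F]); last first.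
  by apply/setP=> F; rewrite !inE subsetT.
rewrite -/(num_free P n).
move/le_trans; apply.
apply: (@le_trans _ _ (2 `^ T0 * 2 `^ (eps / 2 * C))); last first.
  by rewrite -powRD ?pnatr_eq0 ?implybT // -mulrDl epsE.
rewrite ler_wpM2l ?powR_ge0 //.
have -> : eps / 2 * C = 2 * ((2 ^ n)%:R * t).
  by rewrite /t natrX; field; rewrite gt_eqF.
apply: le_trans (expR_le_pow2 _); last by rewrite mulr_ge0.
by rewrite expRM_natl lerXn2r ?nnegrE ?expR_ge0 ?expR_ge1Dx ?addr_ge0.
Qed.
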